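(* Let $\mathfrak g$ be the Lie algebra of a Lie group $G$. Every prederivation $p:T^*\mathfrak g\to T^*\mathfrak g$ has the form $$p(x,f)=\big(\alpha(x)+\psi(f),\ \beta(x)+\xi(f)\big)\qquad\text{for all }(x,f)\in T^*\mathfrak g,$$ where $\alpha:\mathfrak g\to\mathfrak g$ is a prederivation of $\mathfrak g$ and $\beta:\mathfrak g\to\mathfrak g^*$, $\psi:\mathfrak g^*\to\mathfrak g$ and $\xi:\mathfrak g^*\to\mathfrak g^*$ are linear maps satisfying, for all $x,y,z\in\mathfrak g$ and $f,g\in\mathfrak g^*$, $$\beta\big([x,[y,z]]\big)=-ad^*_{[y,z]}\big(\beta(x)\big)+ad^*_x\Big(ad^*_y\big(\beta(z)\big)-ad^*_z\big(\beta(y)\big)\Big),$$ $$\psi\circ ad^*_{[x,y]}=ad_{[x,y]}\circ\psi,$$ $$ad^*_x\big(ad^*_{\psi(f)}g-ad^*_{\psi(g)}f\big)=0,$$ $$\big[\xi,ad^*_{[x,y]}\big]=ad^*_{([\alpha(x),y]+[x,\alpha(y)])}.$$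
   Context: Lie groups and Lie algebras are real and finite dimensional. A prederivation of a Lie algebra $\mathfrak h$ is a linear map $p:\mathfrak h\to\mathfrak h$ with $p([x,[y,z]])=[p(x),[y,z]]+[x,[p(y),z]]+[x,[y,p(z)]]$ for all $x,y,z\in\mathfrak h$. $ad^*_xf=-f\circ ad_x$ for $x\in\mathfrak g$, $f\in\mathfrak g^*$. $T^*\mathfrak g=\mathfrak g\ltimes\mathfrak g^*$ is the Lie algebra with bracket $[(x,f),(y,g)]=([x,y],\,ad^*_xg-ad^*_yf)$. For endomorphisms $A,B$ of a vector space, $[A,B]=A\circ B-B\circ A$. *)

(* Defs.v *)
From HB Require Import structures.
From mathcomp Require Import all_boot all_order all_algebra.
From mathcomp Require Import ring.

Set Implicit Arguments.
Unset Strict Implicit.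
Unset Printing Implicit Defensive.

Import GRing.Theory.
Local Open Scope ring_scope.

Reserved Notation "[ 'lie' x , y ]" (at level 0, x, y at level 99,
  format "[ 'lie'  x ,  y ]").

HB.mixin Record Vector_isLieAlgebra (F : fieldType) V & Vector F V := {
  lie : V -> V -> V;
  lie_linearl : forall y, linear (fun x => lie x y);
  lie_linearr : forall x, linear (lie x);
  liexx : forall x, lie x x = 0;
  lie_jacobi : forall x y z,
    lie x (lie y z) + lie y (lie z x) + lie z (lie x y) = 0
}.

#[short(type="lieAlgType")]
HB.structure Definition LieAlgebra (F : fieldType) :=
  { V of Vector_isLieAlgebra F V & Vector F V }.

Notation "[ 'lie' x , y ]" := (lie x y) : ring_scope.

Definition prederivation (F : fieldType) (h : lieAlgType F) (p : 'End(h)) :=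
  forall x y z : h,
    p [lie x, [lie y, z]]
    = [lie p x, [lie y, z]] + [lie x, [lie p y, z]] + [lie x, [lie y, p z]].

Definition comm_lfun (F : fieldType) (V : vectType F) (A B : 'End(V)) :
  'End(V) := (A \o B)%VF - (B \o A)%VF.

Section Coadjoint.
Variables (F : fieldType) (g : lieAlgType F).
Implicit Types (x y z : g).

Definition dual := 'Hom(g, F^o).

HB.instance Definition _ := Vector.on dual.

Implicit Types (f : dual).

(* [linfun] is only meaningful on linear maps: see [adE] and [coadE]. *)
Definition ad x : 'End(g) := linfun (fun y => [lie x, y]).

Definition coad_fun x f : dual := - (f \o ad x)%VF.

Definition coad x : 'End(dual) := linfun (coad_fun x).

HB.instance Definition _ x := GRing.isLinear.Build F g g _ (lie x) (lie_linearr x).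

Lemma adE x y : ad x y = [lie x, y].
Proof. exact: (lfunE (lie x)). Qed.

Fact coad_fun_linear x : linear (coad_fun x).
Proof.
move=> a f1 f2; apply/lfunP => y; rewrite /coad_fun.
rewrite add_lfunE scale_lfunE !opp_lfunE !comp_lfunE /= add_lfunE scale_lfunE.
by rewrite opprD scalerN.
Qed.

HB.instance Definition _ x :=
  GRing.isLinear.Build F dual dual _ (coad_fun x) (coad_fun_linear x).

Lemma coadE x f : coad x f = - (f \o ad x)%VF.
Proof. exact: (lfunE (coad_fun x)). Qed.

Lemma coadEx x f y : coad x f y = - f [lie x, y].
Proof. by rewrite coadE opp_lfunE comp_lfunE adE. Qed.

(* $T^*\mathfrak g$: the space $\mathfrak g\times\mathfrak g^*$, under an alias
   that carries the semidirect product bracket. *)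
Definition cotangent := (g * dual)%type.

HB.instance Definition _ := Vector.on cotangent.

Definition cotangent_lie (u v : cotangent) : cotangent :=
  ([lie u.1, v.1], coad u.1 v.2 - coad v.1 u.2).

Lemma lieC x y : [lie x, y] = - [lie y, x].
Proof.
have lDl a b c : [lie a + b, c] = [lie a, c] + [lie b, c].
  by have := lie_linearl c 1 a b; rewrite !scale1r.
have := liexx (x + y); rewrite lDl !raddfD /= !liexx add0r addr0.
by move/eqP; rewrite addr_eq0 => /eqP.
Qed.

Lemma coad_linearl f : linear (fun x => coad x f).
Proof.
move=> a x y; apply/lfunP => z.
rewrite add_lfunE scale_lfunE !coadEx lie_linearl linearP.
by rewrite opprD -scalerN.
Qed.

Lemma lie_lie x y z : [lie [lie x, y], z] = [lie x, [lie y, z]] - [lie y, [lie x, z]].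
Proof.
have /eqP := lie_jacobi x y z; rewrite addr_eq0 => /eqP E.
by rewrite lieC -E (lieC z x) raddfN.
Qed.

Lemma coad_lie x y f :
  coad [lie x, y] f = coad x (coad y f) - coad y (coad x f).
Proof.
apply/lfunP => z; rewrite add_lfunE opp_lfunE !coadEx !opprK.
by rewrite lie_lie raddfB opprB.
Qed.

Fact cotangent_lie_linearl v : linear (fun u => cotangent_lie u v).
Proof.
move=> a u w; congr pair => /=; first exact: lie_linearl.
by rewrite coad_linearl linearP /= scalerBr opprD addrACA.
Qed.

Fact cotangent_lie_linearr u : linear (cotangent_lie u).
Proof.
move=> a v w; congr pair => /=; first exact: lie_linearr.
by rewrite coad_linearl linearP /= scalerBr opprD addrACA.
Qed.

Fact cotangent_liexx u : cotangent_lie u u = 0.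
Proof. by rewrite /cotangent_lie liexx subrr. Qed.

Fact cotangent_lie_jacobi u v w :
  cotangent_lie u (cotangent_lie v w) + cotangent_lie v (cotangent_lie w u)
  + cotangent_lie w (cotangent_lie u v) = 0.
Proof.
congr pair => /=; first exact: lie_jacobi.
rewrite !coad_lie !raddfB /=.
move: (coad u.1 (coad v.1 w.2)) (coad u.1 (coad w.1 v.2)) => a b.
move: (coad v.1 (coad w.1 u.2)) (coad v.1 (coad u.1 w.2)) => c d.
move: (coad w.1 (coad u.1 v.2)) (coad w.1 (coad v.1 u.2)) => i j.
apply/lfunP => t; rewrite zero_lfunE !add_lfunE !opp_lfunE.
by move: (a t) (b t) (c t) (d t) (i t) (j t) => ? ? ? ? ? ? /=; ring.
Qed.

HB.instance Definition _ := Vector_isLieAlgebra.Build F cotangent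
  cotangent_lie_linearl cotangent_lie_linearr cotangent_liexx
  cotangent_lie_jacobi.

Lemma cotangent_lieE x y (f h : dual) :
  [lie ((x, f) : cotangent), ((y, h) : cotangent)]
  = ([lie x, y], coad x h - coad y f).
Proof. by []. Qed.

End Coadjoint.

(* Main.v *)
Require Import Defs.
From HB Require Import structures.
From mathcomp Require Import all_boot all_order all_algebra.
From mathcomp Require Import reals.

(** The four maps are the blocks of [p] for the splitting of the cotangent
    algebra into the subalgebra [g] and the abelian ideal [dual g].  All the
    conditions are components of the prederivation identity on triples of
    homogeneous vectors, and three kinds of triples give them all.
    - On [(x, y, z)] in [g], the two components say that the diagonal block
      [alpha] is a prederivation and that [beta] satisfies the twisted
      derivation rule ([prederivation_base]).
    - On [(f, x, y)] with only [f] in [dual g], the first component is the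
      intertwining property of [psi], because the ideal receives every other
      term; the second one is the commutator formula for [xi]
      ([prederivation_fiber]).
    - On [(x, f, h)] with [f] and [h] in [dual g], the left-hand side and the
      bracket of [p x] with [[lie f, h]] vanish because the ideal is abelian; the
      two terms left form the remaining condition ([prederivation_fiber2]). *)

Set Implicit Arguments.
Unset Strict Implicit.
Unset Printing Implicit Defensive.

Import GRing.Theory.
Local Open Scope ring_scope.

Section Blocks.
Variables (F : fieldType) (g : lieAlgType F) (p : 'End(cotangent g)).
Implicit Types (x y z : g) (f h : dual g).

Definition base_incl x : cotangent g := (x, 0).
Definition fiber_incl f : cotangent g := (0, f).

Fact base_incl_linear : linear base_incl.
Proof. by move=> a x y; congr pair; rewrite /= scaler0 addr0. Qed.

Fact fiber_incl_linear : linear fiber_incl.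
Proof. by move=> a f h; congr pair; rewrite /= scaler0 addr0. Qed.

HB.instance Definition _ :=
  GRing.isLinear.Build F g (cotangent g) _ base_incl base_incl_linear.
HB.instance Definition _ :=
  GRing.isLinear.Build F (dual g) (cotangent g) _ fiber_incl fiber_incl_linear.

Definition base_proj (u : cotangent g) : g := u.1.
Definition fiber_proj (u : cotangent g) : dual g := u.2.

Fact base_proj_linear : linear base_proj.
Proof. by []. Qed.

Fact fiber_proj_linear : linear fiber_proj.
Proof. by []. Qed.

HB.instance Definition _ :=
  GRing.isLinear.Build F (cotangent g) g _ base_proj base_proj_linear.
HB.instance Definition _ :=
  GRing.isLinear.Build F (cotangent g) (dual g) _ fiber_proj fiber_proj_linear.

(** The two letters are the source and the target of a block: [g] for the base,
    [d] for the dual. *)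
Definition block_gg : 'End(g) :=
  (linfun base_proj \o p \o linfun base_incl)%VF.
Definition block_gd : 'Hom(g, dual g) :=
  (linfun fiber_proj \o p \o linfun base_incl)%VF.
Definition block_dg : 'Hom(dual g, g) :=
  (linfun base_proj \o p \o linfun fiber_incl)%VF.
Definition block_dd : 'End(dual g) :=
  (linfun fiber_proj \o p \o linfun fiber_incl)%VF.

Lemma p_base x : p (x, 0) = (block_gg x, block_gd x).
Proof. by rewrite !comp_lfunE !lfunE; case: (p _). Qed.

Lemma p_fiber f : p (0, f) = (block_dg f, block_dd f).
Proof. by rewrite !comp_lfunE !lfunE; case: (p _). Qed.

Lemma p_blocks x f :
  p (x, f) = (block_gg x + block_dg f, block_gd x + block_dd f).
Proof.
have -> : ((x, f) : cotangent g) = ((x, 0) : cotangent g) + (0, f).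
  by congr pair; rewrite /= ?addr0 ?add0r.
by rewrite raddfD /= p_base p_fiber.
Qed.

Lemma coad0l f : coad (0 : g) f = 0.
Proof. by have := coad_linearl f (-1) 0 0; rewrite !scaleN1r !addNr. Qed.

Lemma coadDl x y f : coad (x + y) f = coad x f + coad y f.
Proof. by have := coad_linearl f 1 x y; rewrite !scale1r. Qed.

Lemma lie0l x : [lie (0 : g), x] = 0.
Proof. by rewrite lieC raddf0 oppr0. Qed.

Hypothesis pP : prederivation p.

(** The component along [g] ignores [block_gd], since [dual g] is an ideal; the
    component along [dual g] ignores the [block_gg] on the right-hand side,
    since there it only acts on the zero dual parts of the other vectors. *)
Lemma prederivation_base x y z :
  block_gg [lie x, [lie y, z]]
    = [lie block_gg x, [lie y, z]] + [lie x, [lie block_gg y, z]]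
      + [lie x, [lie y, block_gg z]]
  /\ block_gd [lie x, [lie y, z]]
    = - coad [lie y, z] (block_gd x)
      + coad x (coad y (block_gd z) - coad z (block_gd y)).
Proof.
have := pP (x, 0) (y, 0) (z, 0).
rewrite !p_base !cotangent_lieE /= !(raddf0, subr0, sub0r, addr0) p_base.
case=> -> ->; split=> //.
by rewrite -addrA raddfB raddfN [in RHS](addrC (coad x _)).
Qed.

(** Of the three brackets on the right-hand side, only the one that applies [p]
    to [f] has a component along [g], hence the first equation.  Along the
    ideal, [block_gd] is killed by the brackets with [f], so [p x] and [p y]
    count only through [block_gg]. *)
Lemma prederivation_fiber f x y :
  block_dg (coad [lie x, y] f) = [lie [lie x, y], block_dg f]
  /\ block_dd (coad [lie x, y] f)
    = coad [lie x, y] (block_dd f)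
      + coad ([lie block_gg x, y] + [lie x, block_gg y]) f.
Proof.
have := pP (0, f) (x, 0) (y, 0).
rewrite p_fiber !p_base !cotangent_lieE /=.
rewrite !(lie0l, coad0l, raddf0, subr0, sub0r) p_fiber.
rewrite !linearN /=.
case=> Edg Edd; split; apply: oppr_inj.
  by rewrite Edg !addr0 lieC.
by rewrite Edd coadDl !opprD addrA.
Qed.

(** Although [f] and [h] commute, the brackets of [p f] with [h] and of [f] with
    [p h] need not vanish, since [block_dg] moves vectors out of the ideal; the
    identity says that [x] kills the sum of these two brackets. *)
Lemma prederivation_fiber2 x f h :
  coad x (coad (block_dg f) h - coad (block_dg h) f) = 0.
Proof.
have := pP (x, 0) (0, f) (0, h).
rewrite p_base !p_fiber !cotangent_lieE /=.
rewrite !(lie0l, coad0l, raddf0, subr0, sub0r, add0r).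
by case=> _; rewrite raddfB raddfN => <-.
Qed.

End Blocks.

Theorem theoremA (R : realType) (g : lieAlgType R) (p : 'End(cotangent g)) :
  prederivation p ->
  exists (alpha : 'End(g)) (beta : 'Hom(g, dual g))
         (psi : 'Hom(dual g, g)) (xi : 'End(dual g)),
    (forall (x : g) (f : dual g),
       p (x, f) = (alpha x + psi f, beta x + xi f))
    /\ prederivation alpha
    /\ (forall x y z : g,
         beta [lie x, [lie y, z]]
         = - coad [lie y, z] (beta x)
           + coad x (coad y (beta z) - coad z (beta y)))
    /\ (forall x y : g,
         (psi \o coad [lie x, y] = ad [lie x, y] \o psi)%VF)
    /\ (forall (x : g) (f h : dual g),
         coad x (coad (psi f) h - coad (psi h) f) = 0)
    /\ (forall x y : g,
         comm_lfun xi (coad [lie x, y])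
         = coad ([lie alpha x, y] + [lie x, alpha y])).
Proof.
move=> pP; exists (block_gg p), (block_gd p), (block_dg p), (block_dd p).
split; first exact: p_blocks.
split; first by move=> x y z; case: (prederivation_base pP x y z).
split; first by move=> x y z; case: (prederivation_base pP x y z).
split.
  move=> x y; apply/lfunP => f.
  rewrite [LHS]comp_lfunE [RHS]comp_lfunE adE.
  by have [-> _] := prederivation_fiber pP f x y.
split; first exact: prederivation_fiber2.
move=> x y; apply/lfunP => f.
rewrite /comm_lfun add_lfunE opp_lfunE.
rewrite (comp_lfunE (block_dd p)) (comp_lfunE (coad _)).
by have [_ ->] := prederivation_fiber pP f x y; rewrite addrAC subrr add0r.
Qed.
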